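(* The hybrid PtD scheme for the parabolic problem (defined in the context; backward Euler in the K- and L-steps, forward Euler in the S-step) is unconditionally $L^2$-stable: its iterates $U^n=X^nS^n(V^n)^T$ satisfy $$\|U^{n+1}\|_F\le \|U^n\|_F\qquad\text{for all }\Delta t>0.$$
   Context: Let $A\in\mathbb R^{N_v\times N_v}$ be symmetric positive semidefinite, $\Delta t,\Delta x>0$, $\tau:=\frac{\Delta t}{(\Delta x)^2}$. $\|\cdot\|_F$ is the Frobenius norm. Let $E_+,E_-\in\mathbb R^{N_x\times N_x}$ be the periodic shift matrices $(E_+w)_j=w_{j+1}$, $(E_-w)_j=w_{j-1}$ (indices modulo $N_x$), and $M_2=2I-E_+-E_-$ (symmetric positive semidefinite). Origin of the scheme (PtD = project-then-discretize): for the system $\partial_t u^T=\partial_{xx}u^TA$ with $u(t,x)\in\mathbb R^{N_v}$ periodic in $x$, one uses a rank-$r$ ansatz $u^T(t,x)=\chi^T(t,x)S(t)V(t)^T$ with $\chi(t,x)\in\mathbb R^r$, $\int \chi\chi^T\,dx=I_r$, $V^TV=I_r$. With $k^T=\chi^TS$, $L=SV^T$, $\widetilde A=V^TAV$, the projector-splitting subproblems are $\partial_tk^T=\partial_{xx}k^T\widetilde A$, $\dot S=-\left(\int\chi\,\partial_{xx}\chi^T\,dx\right)S\widetilde A$, $\dot L=\left(\int\chi\,\partial_{xx}\chi^T\,dx\right)LA$. These are discretized in $x$ by second-order central differences on a uniform periodic grid $x_1,\dots,x_{N_x}$ of spacing $\Delta x$, where $X\in\mathbb R^{N_x\times r}$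 is the matrix with rows $\sqrt{\Delta x}\,\chi(t,x_j)^T$ and $K=XS$. Resulting hybrid PtD scheme of rank $r\le\min(N_x,N_v)$: the state at time level $n$ is $U^n=X^nS^n(V^n)^T$ with $X^n\in\mathbb R^{N_x\times r}$, $S^n\in\mathbb R^{r\times r}$, $V^n\in\mathbb R^{N_v\times r}$, $(X^n)^TX^n=I_r$, $(V^n)^TV^n=I_r$. One step from $n$ to $n+1$, with $K^n:=X^nS^n$ and $\widetilde A:=(V^n)^TAV^n$, is: K-step: solve $K^{n+1}=K^n-\tau M_2K^{n+1}\widetilde A$ for $K^{n+1}$ and take a QR factorization $K^{n+1}=X^{n+1}S^{(1)}$ with $X^{n+1}\in\mathbb R^{N_x\times r}$ having orthonormal columns. S-step: $S^{(2)}=S^{(1)}+\tau M_{2,X}S^{(1)}\widetilde A$, where $M_{2,X}:=(X^{n+1})^TM_2X^{n+1}$. L-step: with $L^n:=S^{(2)}(V^n)^T$, solve $L^{n+1}=L^n-\tau M_{2,X}L^{n+1}A$ for $L^{n+1}$ and take a QR factorization $(L^{n+1})^T=V^{n+1}(S^{n+1})^T$ with $V^{n+1}\in\mathbb R^{N_v\times r}$ having orthonormal columns. Then $U^{n+1}=X^{n+1}S^{n+1}(V^{n+1})^T=X^{n+1}L^{n+1}$. *)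

(* Defs.v *)
From HB Require Import structures.
From mathcomp Require Import all_boot all_order all_algebra.
From mathcomp Require Import reals.

Set Implicit Arguments.
Unset Strict Implicit.
Unset Printing Implicit Defensive.

Import Order.TTheory GRing.Theory Num.Theory.
Local Open Scope ring_scope.

Definition frobenius_norm (R : realType) (m n : nat) (A : 'M[R]_(m, n)) : R :=
  Num.sqrt (\sum_i \sum_j A i j ^+ 2).

Definition sym_psd (R : realType) (n : nat) (A : 'M[R]_n) : Prop :=
  A^T = A /\ forall v : 'cV[R]_n, 0 <= (v^T *m A *m v) 0 0.

Definition orthonormal_cols (R : realType) (m n : nat) (Q : 'M[R]_(m, n))
  : Prop := Q^T *m Q = 1%:M.

(* [is_trig_mx] means lower triangular, hence the transpose on the right
   factor. Neither a sign condition on its diagonal nor full column rank of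
   [B] is required. *)
Definition is_QR (R : realType) (m n : nat)
    (B Q : 'M[R]_(m, n)) (T : 'M[R]_n) : Prop :=
  [/\ B = Q *m T, orthonormal_cols Q & is_trig_mx T^T].

(* [ordS] and [ord_pred] are the cyclic successor and predecessor on ['I_N], so
   that (shift_plus *m w)_i = w_(i+1) and (shift_minus *m w)_i = w_(i-1), with
   indices modulo N. *)
Definition shift_plus (R : realType) (N : nat) : 'M[R]_N :=
  \matrix_(i, j) (j == ordS i)%:R.

Definition shift_minus (R : realType) (N : nat) : 'M[R]_N :=
  \matrix_(i, j) (j == ord_pred i)%:R.

Definition M2 (R : realType) (N : nat) : 'M[R]_N :=
  2%:M - shift_plus R N - shift_minus R N.

(* One step of the scheme, from (X, S, V) to (X', S', V'). It is a relation
   because QR factorizations are not unique; K', S1, S2, L' stand for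
   K^(n+1), S^(1), S^(2), L^(n+1). *)
Definition PtD_step (R : realType) (Nx Nv r : nat) (A : 'M[R]_Nv) (tau : R)
    (X : 'M[R]_(Nx, r)) (S : 'M[R]_r) (V : 'M[R]_(Nv, r))
    (X' : 'M[R]_(Nx, r)) (S' : 'M[R]_r) (V' : 'M[R]_(Nv, r)) : Prop :=
  let K := X *m S in
  let At := V^T *m A *m V in
  let M2X := X'^T *m M2 R Nx *m X' in
  exists (K' : 'M[R]_(Nx, r)) (S1 S2 : 'M[R]_r) (L' : 'M[R]_(r, Nv)),
    [/\ K' = K - tau *: (M2 R Nx *m K' *m At) /\ is_QR K' X' S1,
        S2 = S1 + tau *: (M2X *m S1 *m At),
        L' = S2 *m V^T - tau *: (M2X *m L' *m A)
      & is_QR L'^T V' S'^T].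

Definition PtD_scheme (R : realType) (Nx Nv r : nat) (A : 'M[R]_Nv)
    (dt dx : R) (X : nat -> 'M[R]_(Nx, r)) (S : nat -> 'M[R]_r)
    (V : nat -> 'M[R]_(Nv, r)) : Prop :=
  [/\ orthonormal_cols (X 0%N), orthonormal_cols (V 0%N)
    & forall n : nat, PtD_step A (dt / dx ^+ 2)
        (X n) (S n) (V n) (X n.+1) (S n.+1) (V n.+1)].

(* Main.v *)
Require Import Defs.
From HB Require Import structures.
From mathcomp Require Import all_boot all_order all_algebra.
From mathcomp Require Import reals.

Set Implicit Arguments.
Unset Strict Implicit.
Unset Printing Implicit Defensive.

Import Order.TTheory GRing.Theory Num.Theory.
Local Open Scope ring_scope.

(** The forward Euler S-step exactly undoes the backward Euler K-step after
    projection: since [K^n = K' + tau M2 K' At] and [K' = X' S1], multiplying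
    by [X'^T] gives [X'^T K^n = S1 + tau M2X S1 At = S2], so S2 is a
    contraction of [K^n].  In the L-step, [L' + tau M2X L' A = S2 V^T], and
    the perturbation has nonnegative Frobenius inner product with [L'],
    because [M2 = D^T D] with [D = I - E_+], whence
    [tr (L'^T M2X L' A) = tr (B A B^T) >= 0] for [B = D X' L']. *)

Lemma frobenius_normE (R : realType) m n (B : 'M[R]_(m, n)) :
  frobenius_norm B = Num.sqrt (\tr (B^T *m B)).
Proof.
rewrite /frobenius_norm exchange_big /=; congr Num.sqrt.
apply: eq_bigr => j _; rewrite mxE; apply: eq_bigr => i _.
by rewrite !mxE expr2.
Qed.

Lemma mxtrace_gram_ge0 (R : realType) m n (B : 'M[R]_(m, n)) :
  0 <= \tr (B^T *m B).
Proof.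
apply: sumr_ge0 => j _; rewrite mxE; apply: sumr_ge0 => i _.
by rewrite !mxE -expr2 sqr_ge0.
Qed.

Lemma frobenius_norm_tr (R : realType) m n (B : 'M[R]_(m, n)) :
  frobenius_norm B^T = frobenius_norm B.
Proof. by rewrite !frobenius_normE trmxK mxtrace_mulC. Qed.

(** The squared norm of [W + Z] exceeds that of [W] by twice the inner product of [W] and [Z] plus
    the squared norm of [Z]. *)
Lemma frobenius_norm_leD (R : realType) m n (W Z : 'M[R]_(m, n)) :
  0 <= \tr (W^T *m Z) -> frobenius_norm W <= frobenius_norm (W + Z).
Proof.
move=> WZ_ge0; rewrite !frobenius_normE ler_wsqrtr //.
have ZW : \tr (Z^T *m W) = \tr (W^T *m Z).
  by rewrite -mxtrace_tr trmx_mul trmxK.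
rewrite [(W + Z)^T]linearD /= mulmxDl !mulmxDr !mxtraceD ZW -addrA lerDl.
by rewrite !addr_ge0 ?mxtrace_gram_ge0.
Qed.

Lemma frobenius_norm_orthonormal_mul (R : realType) m n p
    (Q : 'M[R]_(m, n)) (B : 'M[R]_(n, p)) :
  orthonormal_cols Q -> frobenius_norm (Q *m B) = frobenius_norm B.
Proof.
move=> QQ; rewrite !frobenius_normE trmx_mul.
by rewrite -mulmxA (mulmxA Q^T) QQ mul1mx.
Qed.

Lemma frobenius_norm_mul_orthonormal_tr (R : realType) m n p
    (B : 'M[R]_(p, n)) (Q : 'M[R]_(m, n)) :
  orthonormal_cols Q -> frobenius_norm (B *m Q^T) = frobenius_norm B.
Proof.
move=> QQ; rewrite -frobenius_norm_tr trmx_mul trmxK.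
by rewrite frobenius_norm_orthonormal_mul // frobenius_norm_tr.
Qed.

Lemma frobenius_norm_orthonormal_tr_mul (R : realType) m n p
    (Q : 'M[R]_(m, n)) (B : 'M[R]_(m, p)) :
  orthonormal_cols Q -> frobenius_norm (Q^T *m B) <= frobenius_norm B.
Proof.
move=> QQ; rewrite -(frobenius_norm_orthonormal_mul _ QQ).
(* Pythagoras: [B] is its projection onto the column span of [Q] plus a residual that [Q^T]
   annihilates. *)
rewrite -{2}[B](subrKC (Q *m (Q^T *m B))).
apply: frobenius_norm_leD.
by rewrite trmx_mul -mulmxA mulmxBr !mulmxA QQ mul1mx subrr mulmx0 mxtrace0.
Qed.

(** The two shifts are mutually inverse permutation matrices, hence transposes of each other;
    expanding the product leaves two identities and minus each shift. *)
Lemma M2_gram (R : realType) N :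
  M2 R N = (1%:M - shift_plus R N)^T *m (1%:M - shift_plus R N).
Proof.
have shiftT : (shift_plus R N)^T = shift_minus R N.
  apply/matrixP => i j; rewrite !mxE.
  by rewrite -(inj_eq (@ord_pred_inj N)) ordSK eq_sym.
have shiftK : shift_minus R N *m shift_plus R N = 1%:M.
  apply/matrixP => i j; rewrite !mxE (bigD1 (ord_pred i)) //= big1 => [|k].
    by rewrite !mxE eqxx mul1r addr0 ord_predK eq_sym.
  by rewrite !mxE => /negPf ->; rewrite mul0r.
rewrite [(_ - _)^T]linearB /= trmx1 shiftT mulmxBl
  !mulmxBr !mul1mx mulmx1 shiftK.
rewrite /M2 -[2%:R](@natrD R 1 1) raddfD /= opprB addrA.
by congr (_ - _); rewrite addrAC.
Qed.

(** Each diagonal entry is the quadratic form of [A] evaluated at a row of [B]. *)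
Lemma mxtrace_congr_psd_ge0 (R : realType) m n (A : 'M[R]_n)
    (B : 'M[R]_(m, n)) :
  sym_psd A -> 0 <= \tr (B *m A *m B^T).
Proof.
case=> _ A_ge0; apply: sumr_ge0 => i _.
suff -> : (B *m A *m B^T) i i = ((row i B)^T^T *m A *m (row i B)^T) 0 0 by [].
by rewrite trmxK -row_mul !mxE; apply: eq_bigr => j _; rewrite !mxE.
Qed.

Lemma PtD_step_frobenius_norm_le (R : realType) (Nx Nv r : nat)
    (A : 'M[R]_Nv) (tau : R) (X X' : 'M[R]_(Nx, r)) (S S' : 'M[R]_r)
    (V V' : 'M[R]_(Nv, r)) :
  sym_psd A -> 0 <= tau -> orthonormal_cols V ->
  PtD_step A tau X S V X' S' V' ->
  frobenius_norm (X' *m S' *m V'^T) <= frobenius_norm (X *m S *m V^T).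
Proof.
move=> psdA tau_ge0 VV [K' [S1 [S2 [L' [[eqK [defK' XX _]] defS2 eqL]]]]].
case=> defL' _ _.
have {}defL' : S' *m V'^T = L' by rewrite -[L']trmxK defL' trmx_mul trmxK.
have S2E : S2 = X'^T *m (X *m S).
  move/eqP: eqK; rewrite eq_sym subr_eq => /eqP ->.
  rewrite mulmxDr -scalemxAr {1}defK' mulmxA XX mul1mx defS2 defK'.
  by rewrite !mulmxA.
rewrite -mulmxA defL' frobenius_norm_orthonormal_mul //.
rewrite frobenius_norm_mul_orthonormal_tr //.
apply: le_trans (frobenius_norm_orthonormal_tr_mul _ XX).
rewrite -S2E -(frobenius_norm_mul_orthonormal_tr S2 VV).
(* The implicit equation is read backwards, as a formula for the old [L]; no inverse is ever
   formed. *)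
move/eqP: eqL; rewrite eq_sym subr_eq => /eqP ->.
apply: frobenius_norm_leD; rewrite -scalemxAr mxtraceZ mulr_ge0 //.
pose B := (1%:M - shift_plus R Nx) *m X' *m L'.
suff -> : \tr (L'^T *m (X'^T *m M2 R Nx *m X' *m L' *m A))
          = \tr (B *m A *m B^T) by exact: mxtrace_congr_psd_ge0.
(* Cyclicity of the trace moves [B^T] to the front, where [B^T *m B] restores the factor [M2]. *)
by rewrite [RHS]mxtrace_mulC M2_gram !trmx_mul !mulmxA.
Qed.

Theorem theorem4p4 (R : realType) (Nx Nv r : nat) (A : 'M[R]_Nv) (dx : R)
    (hr : (r <= minn Nx Nv)%N) (hA : sym_psd A) (hdx : 0 < dx) :
  forall dt : R, 0 < dt ->
  forall (X : nat -> 'M[R]_(Nx, r)) (S : nat -> 'M[R]_r)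
    (V : nat -> 'M[R]_(Nv, r)),
  PtD_scheme A dt dx X S V ->
  forall n : nat,
    frobenius_norm (X n.+1 *m S n.+1 *m (V n.+1)^T)
      <= frobenius_norm (X n *m S n *m (V n)^T).
Proof.
move=> dt dt_gt0 X S V [_ V0 step] n.
have tau_ge0 : 0 <= dt / dx ^+ 2 by rewrite divr_ge0 ?sqr_ge0 // ltW.
apply: PtD_step_frobenius_norm_le hA tau_ge0 _ (step n).
(* Orthonormality of [V n] is an initial condition at level 0 and afterwards comes from the QR
   factorization in the preceding L-step. *)
case: n => [//|n].
by case: (step n) => [K' [S1 [S2 [L' [_ _ _ [_ VV _]]]]]].
Qed.
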